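(* Let $\lambda_1,\lambda_2,\dots$ be a sequence of distinct real numbers with $\lambda_j>-1/2$ for all $j$. Let $L_n$ be the Müntz--Legendre polynomials and $K_n$ the Müntz polynomials $$L_1(x)=x^{\lambda_1},\quad L_n(x)=\sum_{j=1}^n c_{j,n}x^{\lambda_j},\quad c_{j,n}=\frac{\prod_{l=1}^{n-1}(\lambda_l+\lambda_j+1)}{\prod_{l=1,\,l\neq j}^n(\lambda_j-\lambda_l)}\ (n\ge2),$$ $$K_n(x)=\sum_{j=1}^n a_{j,n}x^{\lambda_j},\qquad a_{j,n}=\frac{\prod_{l=1}^n(\lambda_j+\lambda_l+1)}{\prod_{l=1,\,l\ne j}^n(\lambda_j-\lambda_l)}\ (n\ge 1),$$ with $K_0\equiv 0$. Then for all $n\ge1$ and $0<x\le 1$ the following hold. 1) $$K_n(x)=\sum_{j=1}^n(1+2\lambda_j)L_j(x).$$ In particular $K_n(1)=\sum_{j=1}^n(1+2\lambda_j)$. Consequently $$K_n(x)=x^{-\lambda_n}\frac{\partial}{\partial x}\big(x^{\lambda_n+1}L_n(x)\big)$$ and, equivalently, $$L_n(x)=x^{-\lambda_n-1}\int_0^x s^{\lambda_n}K_n(s)\,ds.$$ Moreover, unlike the Müntz--Legendre polynomials, $K_n$ does not depend on the order of $\lambda_1,\dots,\lambda_n$. 2) The sequence $(K_n)$ satisfies the integro-difference equation $$K_n(x)=K_{n-1}(x)+(2\lambda_n+1)x^{\lambda_n}\Big(1-\int_x^1 u^{-\lambda_n-1}K_{n-1}(u)\,du\Big).$$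
   Context: Empty products are equal to $1$. *)

(* Defs.v *)
From HB Require Import structures.
From mathcomp Require Import all_boot all_order all_algebra.
From mathcomp Require Import all_classical all_reals all_analysis.
Set Implicit Arguments.
Unset Strict Implicit.
Unset Printing Implicit Defensive.
Import Order.TTheory GRing.Theory Num.Theory.
Import numFieldNormedType.Exports.
Local Open Scope ring_scope.

(* An exponent sequence lambda_1, lambda_2, ... is a function [lam : nat -> R]
   of which only the values at indices >= 1 are used; [lam 0] is irrelevant. *)

Definition muntz_legendre_coef (R : realType) (lam : nat -> R) (j n : nat) : R :=
  (\prod_(1 <= l < n) (lam l + lam j + 1)) /
  (\prod_(1 <= l < n.+1 | l != j) (lam j - lam l)).

(* L_n; for n = 1 both products are empty, so that L_1(x) = x^lambda_1
   (see [muntz_legendre1]). *)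
Definition muntz_legendre (R : realType) (lam : nat -> R) (n : nat) (x : R) : R :=
  \sum_(1 <= j < n.+1) muntz_legendre_coef lam j n * x `^ lam j.

Definition muntz_coef (R : realType) (lam : nat -> R) (j n : nat) : R :=
  (\prod_(1 <= l < n.+1) (lam j + lam l + 1)) /
  (\prod_(1 <= l < n.+1 | l != j) (lam j - lam l)).

Definition muntz (R : realType) (lam : nat -> R) (n : nat) (x : R) : R :=
  \sum_(1 <= j < n.+1) muntz_coef lam j n * x `^ lam j.

Lemma muntz_legendre1 (R : realType) (lam : nat -> R) (x : R) :
  muntz_legendre lam 1 x = x `^ lam 1%N.
Proof.
rewrite /muntz_legendre big_nat1 /muntz_legendre_coef big_geq //.
by rewrite big_mkcond big_nat1 eqxx /= divr1 mul1r.
Qed.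

Lemma muntz0 (R : realType) (lam : nat -> R) (x : R) : muntz lam 0 x = 0.
Proof. by rewrite /muntz big_geq. Qed.

(* mu_1, ..., mu_n is a reordering of lam_1, ..., lam_n. *)
Definition reordering (R : realType) (n : nat) (lam mu : nat -> R) : bool :=
  perm_eq [seq mu i | i <- iota 1 n] [seq lam i | i <- iota 1 n].

(* Main.v *)
Require Import Defs.
From HB Require Import structures.
From mathcomp Require Import all_boot all_order all_algebra.
From mathcomp Require Import all_classical all_reals all_analysis.
From mathcomp Require Import measurable_realfun qpoly zify ring lra.
Import Order.TTheory GRing.Theory Num.Theory.
Import numFieldNormedType.Exports.
Local Open Scope ring_scope.

(* Writing a_{j,n} = (lambda_j + lambda_n + 1) c_{j,n} and
   c_{j,n} = a_{j,n-1} / (lambda_j - lambda_n) for j < n gives the recursion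
   K_n = K_{n-1} + (1 + 2 lambda_n) L_n, hence the expansion of K_n. The sum of
   the c_{j,n} is the divided difference of order n-1 of the monic polynomial
   prod_(l < n) (z + lambda_l + 1) of degree n-1, so L_n(1) = 1. The
   differential and integral identities are term-by-term integrations of powers,
   the exponents in the integral from 0 being > -1. *)

Set Implicit Arguments.
Unset Strict Implicit.
Unset Printing Implicit Defensive.

(* Leading coefficients in the Lagrange interpolation formula of p. *)
Lemma sum_divided_difference (F : fieldType) (y : nat -> F) (n : nat)
    (p : {poly F}) :
    injective y -> p \is monic -> size p = n.+1 ->
  \sum_(i < n.+1) p.[y i] / \prod_(j < n.+1 | j != i) (y i - y j) = 1.
Proof.
move=> y_inj p_monic sz_p.
have /(congr1 (fun q : {poly F} => q`_n)) :=
  lagrange_gen (ltn0Sn n) y_inj (eq_leq sz_p).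
have -> : p`_n = 1 by move: p_monic; rewrite monicE /lead_coef sz_p => /eqP.
rewrite coef_sum => p1; rewrite [RHS]p1; apply: eq_bigr => i _.
rewrite coefCM lagrangeE //= coefCM horner_prod; congr (_ * _).
rewrite -[LHS]mulr1; congr (_^-1 * _).
  by apply: eq_bigr => j _; rewrite hornerXsubC.
set q := \prod_(j < _ | _) _.
(* [q] is a product of n monic linear factors, so its coefficient of index n is its leading
   coefficient, which is 1. *)
have <- : (size q).-1 = n.
  rewrite size_prod /=; last by move=> j _; rewrite polyXsubC_eq0.
  rewrite (eq_bigr (fun=> 2%N)) => [|j _]; last by rewrite size_XsubC.
  by rewrite sum_nat_const cardC1 card_ord /= muln2 -addnn subSn ?leq_addr // addnK.
by apply/esym/monicP/monic_prod_XsubC.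
Qed.

(** * Coefficient recursions, the expansion of K_n and the values at 1 *)

Section Algebra.
Context (R : realType) (lam : nat -> R).
Local Notation L := (muntz_legendre lam).
Local Notation K := (muntz lam).
Local Notation c := (muntz_legendre_coef lam).
Local Notation a := (muntz_coef lam).

Lemma muntz_coefE j n : (1 <= n)%N -> a j n = (lam j + lam n + 1) * c j n.
Proof.
case: n => // n _; rewrite /muntz_coef /muntz_legendre_coef big_nat_recr //=.
rewrite mulrA; congr (_ / _); rewrite mulrC; congr (_ * _).
by apply: eq_bigr => l _; rewrite (addrC (lam l)).
Qed.

Lemma muntz_legendre_coefS j n : (j <= n)%N ->
  c j n.+1 = a j n / (lam j - lam n.+1).
Proof.
move=> jn; rewrite /muntz_coef /muntz_legendre_coef.
(* Turning the condition [l != j] into a factor 1 lets the last factor be split off; as j <= n, that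
   factor is the genuine lambda_j - lambda_(n+1). *)
rewrite !(big_mkcond (fun l => l != j)) (big_nat_recr n.+1) //=.
rewrite (_ : n.+1 != j) ?gtn_eqF// invfM mulrA; congr (_ / _ / _).
by apply: eq_bigr => l _; rewrite (addrC (lam l)).
Qed.

Context (lam_distinct : forall i j : nat,
  (1 <= i)%N -> (1 <= j)%N -> i <> j -> lam i <> lam j).

(** With c = c_{j,n+1}, both a_{j,n+1} and a_{j,n} are multiples of c, by lambda_j + lambda_(n+1) +
    1 and lambda_j - lambda_(n+1); these differ by 1 + 2 lambda_(n+1), whatever j is. *)
Lemma muntz_coef_recr j n : (1 <= j <= n)%N ->
  a j n.+1 = a j n + (1 + 2 * lam n.+1) * c j n.+1.
Proof.
move=> /andP[j1 jn]; rewrite muntz_coefE // muntz_legendre_coefS //.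
have : lam j - lam n.+1 != 0.
  by rewrite subr_eq0; apply/eqP/lam_distinct => // jE; rewrite jE ltnn in jn.
by move=> ?; field.
Qed.

Lemma muntz_recr n x : K n.+1 x = K n x + (1 + 2 * lam n.+1) * L n.+1 x.
Proof.
rewrite /muntz /muntz_legendre (big_nat_recr n.+1) // (big_nat_recr n.+1) //= mulrDr addrA.
(* The top term j = n+1 has no counterpart in K_n: there a_{j,j} = (1 + 2 lambda_j) c_{j,j}. *)
congr (_ + _); last by rewrite muntz_coefE // mulrA; congr (_ * _ * _); ring.
rewrite big_distrr -big_split /= !big_nat; apply: eq_bigr => j jn.
by rewrite muntz_coef_recr // mulrDl mulrA.
Qed.

Lemma muntz_sum n x :
  K n x = \sum_(1 <= j < n.+1) (1 + 2 * lam j) * L j x.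
Proof.
elim: n => [|n IHn]; first by rewrite muntz0 big_geq.
by rewrite muntz_recr big_nat_recr //= IHn.
Qed.

Lemma sum_muntz_legendre_coef n : (1 <= n)%N -> \sum_(1 <= j < n.+1) c j n = 1.
Proof.
(* The shift drops the unconstrained value [lam 0], so that the nodes are injective on all of
   [nat]. *)
case: n => // n _; pose y i := lam i.+1.
have y_inj : injective y.
  move=> i j yij; apply/eqP; apply/negPn/negP => /eqP ij.
  by apply: (@lam_distinct i.+1 j.+1) => // -[].
(* The value of [p] at lambda_j is the numerator of c_{j,n+1}. *)
pose p := \prod_(l < n) ('X - (- (y l + 1))%:P).
have sz_p : size p = n.+1.
  by rewrite size_prod_XsubC -[index_enum _]enumT size_enum_ord.
rewrite -[RHS](sum_divided_difference y_inj (monic_prod_XsubC _ _ _) sz_p).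
rewrite big_add1 big_mkord; apply: eq_bigr => i _; rewrite horner_prod.
rewrite /muntz_legendre_coef !big_add1 !big_mkord; congr (_ / _).
by apply: eq_bigr => l _; rewrite hornerXsubC /y; ring.
Qed.

Lemma muntz_legendre_at1 n : (1 <= n)%N -> L n 1 = 1.
Proof.
move=> n1; rewrite -[RHS](sum_muntz_legendre_coef n1).
by apply: eq_bigr => j _; rewrite powR1 mulr1.
Qed.

Lemma muntz_at1 n : K n 1 = \sum_(1 <= j < n.+1) (1 + 2 * lam j).
Proof.
rewrite muntz_sum !big_nat; apply: eq_bigr => j /andP[j1 _].
by rewrite muntz_legendre_at1 // mulr1.
Qed.

End Algebra.

(** * Independence of K_n from the order of the exponents *)

Lemma uniq_map_inj (T U : eqType) (f : T -> U) (s : seq T) :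
  uniq (map f s) -> {in s &, injective f}.
Proof.
elim: s => //= t s IHs /andP[ft /IHs f_inj] u v.
rewrite !inE => /predU1P[->|us] /predU1P[->|vs] // fuv.
- by rewrite fuv map_f in ft.
- by rewrite -fuv map_f in ft.
- exact: f_inj.
Qed.

(** Here the sum and products run over exponent values instead of indices, so invariance under
    reordering becomes invariance of big operators under permutation. Distinctness of the values
    makes [l != j] equivalent to [lam l != lam j]. *)
Lemma muntz_seqE (R : realType) (lam : nat -> R) (n : nat) (x : R) :
    uniq [seq lam i | i <- iota 1 n] ->
  let s := [seq lam i | i <- iota 1 n] in
  muntz lam n x =
    \sum_(u <- s) (\prod_(v <- s) (u + v + 1)) /
      (\prod_(v <- s | v != u) (u - v)) * x `^ u.
Proof.
move=> us s; rewrite /muntz /s big_map /index_iota subSS subn0.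
rewrite !big_seq; apply: eq_bigr => j jn; rewrite /muntz_coef !big_map.
rewrite /index_iota subSS subn0; congr (_ / _ * _).
rewrite big_seq_cond [RHS]big_seq_cond; apply: eq_bigl => l.
have [ln|//] := boolP (l \in iota 1 n); congr (~~ _).
apply/idP/idP => [/eqP -> //|/eqP lamE]; apply/eqP.
exact: (uniq_map_inj us).
Qed.

Lemma muntz_reordering (R : realType) (lam mu : nat -> R) (n : nat) (x : R) :
    uniq [seq lam i | i <- iota 1 n] -> reordering n lam mu ->
  muntz mu n x = muntz lam n x.
Proof.
move=> us mulam; rewrite !muntz_seqE ?(perm_uniq mulam) //.
rewrite (perm_big _ mulam) /=; apply: eq_bigr => u _.
by congr (_ / _ * _); rewrite (perm_big _ mulam).
Qed.

(** * Integrals of real powers *)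

Lemma integral_powR_itvcc (R : realType) (p x y : R) : p != -1 -> 0 < x -> x < y ->
  (\int[@lebesgue_measure R]_(s in `[x, y]) (s `^ p)%:E =
   ((y `^ (p + 1) - x `^ (p + 1)) / (p + 1))%:E)%E.
Proof.
move=> pN1 x0 xy; have p10 : p + 1 != 0 by rewrite addr_eq0.
pose F (s : R) := s `^ (p + 1) / (p + 1).
have dF (s : R) : 0 < s -> is_derive s 1 F (s `^ p).
  move=> s0; rewrite /F.
  have -> : s `^ p = (p + 1)^-1 *: ((p + 1) * s `^ (p + 1 - 1)).
    by rewrite addrK /GRing.scale /= mulKf.
  have -> : (fun t : R => t `^ (p + 1) / (p + 1)) =
            (p + 1)^-1 *: (fun t : R => t `^ (p + 1)).
    by apply/funext => t; rewrite mulrC.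
  by apply: is_deriveZ; exact: is_derive1_powR.
rewrite (@continuous_FTC2 _ _ F) //.
- by rewrite -EFinB /F mulrBl.
- apply: derivable_within_continuous => s; rewrite in_itv /= => /andP[xs _].
  by apply: derivable_powR; rewrite in_itv /= andbT (lt_le_trans x0).
- have dF1 (s : R) : 0 < s -> derivable F s 1 by move=> /dF [].
  have cF (s : R) : 0 < s -> {for s, continuous F}.
    by move=> /dF1 ?; apply/differentiable_continuous/derivable1_diffP.
  split.
  + move=> s; rewrite in_itv /= => /andP[xs _].
    by apply: dF1; rewrite (lt_trans x0).
  + by apply: cvg_at_right_filter; exact: cF.
  + by apply: cvg_at_left_filter; apply: cF; exact: lt_trans xy.
- move=> s; rewrite in_itv /= => /andP[xs _].
  by rewrite derive1E; have [_ ->] := dF s (lt_trans x0 xs).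
Qed.

Section IntegralPowR.
Local Open Scope classical_set_scope.

(** The interval is exhausted by the segments [1/(k+1), x]. Monotone convergence applies since
    powers are nonnegative, and the lower boundary term vanishes in the limit because p + 1 > 0. *)
Lemma integral_powR_itv0c (R : realType) (p x : R) : -1 < p -> 0 < x ->
  (\int[@lebesgue_measure R]_(s in `]0%R, x]) (s `^ p)%:E =
   (x `^ (p + 1) / (p + 1))%:E)%E.
Proof.
move=> pN1 x0; have p10 : 0 < p + 1 by lra.
pose F (k : nat) : set R := `[k.+1%:R^-1, x].
have -> : `]0, x] = (\bigcup_k F k).
  by rewrite itv_open_bnd_bigcup; apply: eq_bigcupr => k _; rewrite add0r.
have /cvg_lim <- // : (\int[@lebesgue_measure R]_(s in F k) (s `^ p)%:E
    @[k --> \oo] --> \int[@lebesgue_measure R]_(s in (\bigcup_k F k)) (s `^ p)%:E)%E.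
  apply: ge0_nondecreasing_set_cvg_integral => //.
  - apply/nondecreasing_seqP => k; rewrite subsetEset /F => s /=.
    rewrite !in_itv /= => /andP[ks ->]; rewrite andbT (le_trans _ ks) //.
    by rewrite lef_pV2 ?posrE // ler_nat.
  - by move=> k; exact: measurable_itv.
  - move=> k; apply/measurable_EFinP/measurable_funTS; exact: measurable_powR.
  - by move=> k s _; rewrite lee_fin powR_ge0.
pose G (e : R) := (x `^ (p + 1) - e `^ (p + 1)) / (p + 1).
have FG : \forall k \near \oo,
    (G k.+1%:R^-1)%:E = (\int[@lebesgue_measure R]_(s in F k) (s `^ p)%:E)%E.
  (* The closed form holds only eventually: it requires 1/(k+1) < x. *)
  near=> k; rewrite integral_powR_itvcc //; first by rewrite gt_eqF.
  by near: k; exact: near_infty_natSinv_lt (PosNum x0).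
apply/cvg_lim => //; apply: cvg_trans (near_eq_cvg FG) _.
apply: cvg_EFin; first exact: nearW.
rewrite -[x `^ (p + 1)]subr0; apply: cvgMl; apply: cvgB; first exact: cvg_cst.
have /cvg_at_rightP := powR_cvg0 p10.
apply; split => [k|]; first by rewrite invr_gt0.
exact: cvg_harmonic.
Unshelve. all: by end_near. Qed.

End IntegralPowR.

(** * Differentiation and integration of finite linear combinations *)

Lemma is_derive_powR_sum (R : realType) (r : seq nat) (b p : nat -> R) (x : R) :
    0 < x ->
  is_derive x 1 (fun t : R => \sum_(j <- r) b j * t `^ p j)
    (\sum_(j <- r) b j * (p j * x `^ (p j - 1))).
Proof.
move=> x0; elim: r => [|j r IHr].
  rewrite big_nil (_ : (fun _ => _) = cst 0); first exact: is_derive_cst.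
  by apply/funext => t; rewrite big_nil.
rewrite big_cons (_ : (fun _ => _) =
  (b j *: (fun t : R => t `^ p j)) + (fun t : R => \sum_(j <- r) b j * t `^ p j)).
  apply: is_deriveD; apply: is_deriveZ; exact: is_derive1_powR.
by apply/funext => t; rewrite big_cons.
Qed.

Lemma integrable_sumZ (d : measure_display) (T : measurableType d)
    (R : realType) (mu : {measure set T -> \bar R}) (D : set T) (I : eqType)
    (r : seq I) (b : I -> R) (f : I -> T -> R) :
    measurable D -> {in r, forall i, mu.-integrable D (EFin \o f i)} ->
  mu.-integrable D (EFin \o (fun t => \sum_(i <- r) b i * f i t)).
Proof.
move=> mD intf.
have -> : EFin \o (fun t => \sum_(i <- r) b i * f i t) =
    (fun t => \sum_(i <- r | i \in r) ((b i)%:E * (EFin \o f i) t))%E.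
  by apply/funext => t /=; rewrite -big_seq -sumEFin; apply: eq_bigr.
by apply: integrable_sum => // i ir; apply: integrableZl => //; exact: intf.
Qed.

Lemma Rintegral_sumZ (d : measure_display) (T : measurableType d)
    (R : realType) (mu : {measure set T -> \bar R}) (D : set T) (I : eqType)
    (r : seq I) (b : I -> R) (f : I -> T -> R) :
    measurable D -> {in r, forall i, mu.-integrable D (EFin \o f i)} ->
  \int[mu]_(t in D) (\sum_(i <- r) b i * f i t) =
  \sum_(i <- r) b i * \int[mu]_(t in D) f i t.
Proof.
move=> mD; elim: r => [|i r IHr] intf.
  under eq_Rintegral do rewrite big_nil.
  by rewrite big_nil Rintegral_cst // mul0r.
have intfi : mu.-integrable D (EFin \o f i) by apply: intf; exact: mem_head.
have intfr : {in r, forall j, mu.-integrable D (EFin \o f j)}.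
  by move=> j jr; apply: intf; rewrite inE jr orbT.
under eq_Rintegral do rewrite big_cons.
rewrite RintegralD ?big_cons ?IHr ?RintegralZl //; last exact: integrable_sumZ.
rewrite (_ : _ \o _ = fun t => ((b i)%:E * (EFin \o f i) t)%E) //.
exact: integrableZl.
Qed.

Lemma integrable_powR_itvcc (R : realType) (p x y : R) : 0 < x ->
  (@lebesgue_measure R).-integrable `[x, y] (EFin \o (fun s : R => s `^ p)).
Proof.
move=> x0; apply: continuous_compact_integrable; first exact: segment_compact.
apply: derivable_within_continuous => s; rewrite in_itv /= => /andP[xs _].
by apply: derivable_powR; rewrite in_itv /= andbT (lt_le_trans x0).
Qed.

Lemma Rintegral_powR_itvcc (R : realType) (p x y : R) :
    p != -1 -> 0 < x -> x <= y ->
  \int[@lebesgue_measure R]_(s in `[x, y]) (s `^ p) =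
  (y `^ (p + 1) - x `^ (p + 1)) / (p + 1).
Proof.
move=> pN1 x0; rewrite le_eqVlt => /predU1P[<-|xy].
  (* The degenerate segment is kept because the integral from x to 1 is also taken at x = 1. *)
  by rewrite set_itv1 Rintegral_set1 subrr mul0r.
by rewrite /Rintegral integral_powR_itvcc.
Qed.

Lemma integrable_powR_itv0c (R : realType) (p x : R) : -1 < p -> 0 < x ->
  (@lebesgue_measure R).-integrable `]0, x] (EFin \o (fun s : R => s `^ p)).
Proof.
move=> pN1 x0; apply/integrableP; split.
  by apply/measurable_EFinP/measurable_funTS; exact: measurable_powR.
under eq_integral do rewrite /= ger0_norm ?powR_ge0 //.
by rewrite integral_powR_itv0c // ltry.
Qed.

Lemma Rintegral_powR_itv0c (R : realType) (p x : R) : -1 < p -> 0 < x ->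
  \int[@lebesgue_measure R]_(s in `]0, x]) (s `^ p) = x `^ (p + 1) / (p + 1).
Proof. by move=> pN1 x0; rewrite /Rintegral integral_powR_itv0c. Qed.

Lemma powR_mul_sum (R : realType) (r : seq nat) (b p : nat -> R) (q t : R) :
    0 < t ->
  t `^ q * (\sum_(j <- r) b j * t `^ p j) = \sum_(j <- r) b j * t `^ (p j + q).
Proof.
move=> t0; rewrite big_distrr /=; apply: eq_bigr => j _.
by rewrite powRD ?(gt_eqF t0) ?implybT // mulrCA (mulrC (t `^ q)).
Qed.

(** * The differential and integral formulas linking L_n and K_n *)

Section Calculus.
Context (R : realType) (lam : nat -> R) (n : nat).
Context (n_ge1 : (1 <= n)%N).
Local Notation L := (muntz_legendre lam).
Local Notation K := (muntz lam).

(** Termwise, lambda_j c_{j,n} = a_{j,n} - (lambda_n + 1) c_{j,n}, which gives x L_n' = K_n -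
    (lambda_n + 1) L_n. *)
Lemma is_derive_muntz_legendre (x : R) : 0 < x ->
  is_derive x 1 (L n) ((K n x - (lam n + 1) * L n x) / x).
Proof.
move=> x0; have := is_derive_powR_sum (index_iota 1 n.+1)
  (muntz_legendre_coef lam ^~ n) lam x0.
congr is_derive; rewrite /muntz /muntz_legendre big_distrr -sumrB big_distrl /=.
apply: eq_bigr => j _; rewrite muntz_coefE //.
rewrite powRB ?(gt_eqF x0) ?implybT // powRr1 ?ltW //; ring.
Qed.

Lemma is_derive_powR_muntz_legendre (x : R) : 0 < x ->
  is_derive x 1 (fun t : R => t `^ (lam n + 1) * L n t) (x `^ lam n * K n x).
Proof.
move=> x0; have dL := is_derive_muntz_legendre x0.
have -> : x `^ lam n * K n x =
    x `^ (lam n + 1) *: ((K n x - (lam n + 1) * L n x) / x) +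
    L n x *: ((lam n + 1) * x `^ (lam n + 1 - 1)).
  rewrite /GRing.scale /= addrK powRD ?(gt_eqF x0) ?implybT // powRr1 ?ltW //.
  by field; rewrite gt_eqF.
exact: is_deriveM (is_derive1_powR (lam n + 1) x0) dL.
Qed.

Context (lam_gt : forall j : nat, (1 <= j)%N -> - (1 / 2) < lam j).

Lemma integral_powR_muntz (x : R) : 0 < x ->
  (@lebesgue_measure R).-integrable `]0, x]
      (fun s : R => (s `^ lam n * K n s)%:E) /\
  \int[@lebesgue_measure R]_(s in `]0, x]) (s `^ lam n * K n s) =
    x `^ (lam n + 1) * L n x.
Proof.
move=> x0.
have powE : {in `]0%R, x]%classic, forall s, s `^ lam n * K n s =
    \sum_(1 <= j < n.+1) muntz_coef lam j n * s `^ (lam j + lam n)}.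
  by move=> s; rewrite inE /= in_itv /= => /andP[s0 _]; rewrite powR_mul_sum.
(* The bound -1/2 on each exponent gives integrability at 0, and also makes lambda_j + lambda_n + 1
   nonzero; dividing a_{j,n} by it yields c_{j,n}. *)
have lam_gtN1 j : j \in index_iota 1 n.+1 -> -1 < lam j + lam n.
  rewrite mem_index_iota => /andP[j1 _].
  have := lam_gt j1; have := lam_gt n_ge1; lra.
have intp : {in index_iota 1 n.+1, forall j,
    (@lebesgue_measure R).-integrable `]0, x]
      (EFin \o (fun s : R => s `^ (lam j + lam n)))}.
  by move=> j jn; apply: integrable_powR_itv0c => //; exact: lam_gtN1.
split.
  apply: eq_integrable (integrable_sumZ (muntz_coef lam ^~ n) _ intp) => //.
  by move=> s sx /=; rewrite powE.
under eq_Rintegral => s sx do rewrite powE //.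
rewrite Rintegral_sumZ // powR_mul_sum // !big_seq.
apply: eq_bigr => j jn; have lamN1 := lam_gtN1 _ jn.
rewrite Rintegral_powR_itv0c // muntz_coefE // -!addrA.
by field; rewrite gt_eqF //; lra.
Qed.

End Calculus.

(** * The integral from x to 1 in the integro-difference equation *)

Lemma integral_powRN_muntz (R : realType) (lam : nat -> R) (n : nat)
    (x : R) :
    (forall i j : nat,
       (1 <= i)%N -> (1 <= j)%N -> i <> j -> lam i <> lam j) ->
    0 < x -> x <= 1 ->
  (@lebesgue_measure R).-integrable `[x, 1]
     (fun u : R => (u `^ (- lam n.+1 - 1) * muntz lam n u)%:E) /\
  x `^ lam n.+1 * (1 - \int[@lebesgue_measure R]_(u in `[x, 1])
              (u `^ (- lam n.+1 - 1) * muntz lam n u)) =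
    muntz_legendre lam n.+1 x.
Proof.
move=> lam_distinct x0 x1.
have powE : {in `[x, 1]%classic, forall u,
    u `^ (- lam n.+1 - 1) * muntz lam n u =
    \sum_(1 <= j < n.+1) muntz_coef lam j n * u `^ (lam j + (- lam n.+1 - 1))}.
  move=> u; rewrite inE /= in_itv /= => /andP[xu _].
  by rewrite powR_mul_sum // (lt_le_trans x0).
have intp : {in index_iota 1 n.+1, forall j,
    (@lebesgue_measure R).-integrable `[x, 1]
      (EFin \o (fun u : R => u `^ (lam j + (- lam n.+1 - 1))))}.
  by move=> j _; exact: integrable_powR_itvcc.
split.
  apply: eq_integrable (integrable_sumZ (muntz_coef lam ^~ n) _ intp) => //.
  by move=> u ux /=; rewrite powE.
under eq_Rintegral => s sx do rewrite powE //.
rewrite Rintegral_sumZ //.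
(* The j-th integral contributes c_{j,n+1} (1 - x^(lambda_j - lambda_(n+1))). Writing the leading 1
   as the sum of all c_{j,n+1} cancels the constants for j <= n and leaves c_{n+1,n+1} as the top
   coefficient of L_(n+1). *)
rewrite -[X in X - \sum_(j <- _) _](sum_muntz_legendre_coef lam_distinct (isT : 1 <= n.+1)%N).
rewrite /muntz_legendre !(big_nat_recr n.+1) //= addrAC -sumrB mulrDr.
congr (_ + _); last by rewrite mulrC.
rewrite big_distrr /= !big_nat; apply: eq_bigr => j /andP[j1 jn].
have lamj : lam j - lam n.+1 != 0.
  by rewrite subr_eq0; apply/eqP/lam_distinct => // jE; rewrite jE ltnn in jn.
have -> : lam j + (- lam n.+1 - 1) = lam j - lam n.+1 - 1 by ring.
rewrite Rintegral_powR_itvcc //; last by rewrite -subr_eq0 opprK subrK.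
rewrite subrK powR1 muntz_legendre_coefS // powRB ?(gt_eqF x0) ?implybT //.
by field; rewrite lamj powR_eq0 (gt_eqF x0).
Qed.

(** * Dependence of L_n on the order of the exponents *)

Lemma muntz_legendre_order_dependent (R : realType) (lam : nat -> R) (n : nat) :
    (forall i j : nat,
       (1 <= i)%N -> (1 <= j)%N -> i <> j -> lam i <> lam j) ->
    (2 <= n)%N ->
  exists mu : nat -> R, reordering n lam mu /\
    exists y : R, 0 < y /\ y <= 1 /\
      muntz_legendre mu n y <> muntz_legendre lam n y.
Proof.
move=> lam_distinct n2; have n1 : (1 <= n)%N by exact: ltnW.
(* The witness swaps the first and last exponents, so that the last one changes from lambda_n to
   lambda_1. *)
pose tau i := if i == 1%N then n else if i == n then 1%N else i.
have tauK : involutive tau.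
  move=> i; rewrite /tau; have [->|i1] := eqVneq i 1%N.
    by rewrite eqxx; case: eqVneq => // ->.
  by have [->|iN] := eqVneq i n; rewrite ?eqxx // (negPf i1) (negPf iN).
pose mu i := lam (tau i); exists mu.
have mulam : reordering n lam mu.
  rewrite /reordering /mu map_comp perm_map //; apply: uniq_perm.
  - by rewrite map_inj_uniq ?iota_uniq //; exact: inv_inj.
  - exact: iota_uniq.
  - move=> i; rewrite -{1}[i]tauK mem_map; last exact: inv_inj.
    rewrite !mem_iota /tau; have [->|i1] := eqVneq i 1%N; first by lia.
    by have [->|iN] := eqVneq i n; lia.
split=> //; apply: contrapT => noy.
have eqL y : 0 < y -> y <= 1 -> muntz_legendre mu n y = muntz_legendre lam n y.
  by move=> y0 y1; apply: contrapT => neq; apply: noy; exists y.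
have us : uniq [seq lam i | i <- iota 1 n].
  rewrite map_inj_in_uniq ?iota_uniq // => i j.
  rewrite !mem_iota => /andP[i1 _] /andP[j1 _] lamE.
  by apply: contrapT => /lam_distinct; apply.
(* x L_n' = K_n - (lam_n + 1) L_n and K_n is order-independent, so equality for
   both orders forces (lam_1 - lam_n) L_n = 0, whereas L_n(1) = 1. *)
have L0 y : 0 < y -> y < 1 -> muntz_legendre lam n y = 0.
  move=> y0 y1.
  have [_ dlam] := is_derive_muntz_legendre lam n1 y0.
  have [_ dmu] := is_derive_muntz_legendre mu n1 y0.
  have : 'D_1 (muntz_legendre mu n) y = 'D_1 (muntz_legendre lam n) y.
    apply: near_eq_derive; near=> t; apply: eqL.
      by near: t; exact: lt_nbhsr.
    by apply: ltW; near: t; exact: lt_nbhsl.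
  rewrite dlam dmu (muntz_reordering _ us mulam) eqL ?(ltW y1) //.
  move=> /(mulIf (invr_neq0 (lt0r_neq0 y0)))/addrI/oppr_inj/eqP.
  rewrite -subr_eq0 -mulrBl mulf_eq0 => /orP[|/eqP //].
  rewrite (_ : _ - _ = lam 1%N - lam n); last first.
    by rewrite /mu /tau eqxx gtn_eqF //; ring.
  by rewrite subr_eq0 => /eqP/lam_distinct => /(_ isT n1); lia.
(* Comparing derivatives needs a two-sided neighbourhood inside ]0, 1], so L_n vanishes only for y <
   1 so far; the value at 1 is reached by a left limit. *)
have L1 : (muntz_legendre lam n t @[t --> 1^'-] --> (1 : R))%classic.
  rewrite -[X in (_ --> X)%classic](muntz_legendre_at1 lam_distinct n1).
  apply: cvg_at_left_filter; apply/differentiable_continuous/derivable1_diffP.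
  by have [] := is_derive_muntz_legendre lam n1 (@ltr01 R).
have : (muntz_legendre lam n t @[t --> 1^'-] --> (0 : R))%classic.
  apply: (@cvg_trans _ (cst (0 : R) t @[t --> 1^'-])%classic).
    apply: near_eq_cvg; near=> t; apply/esym/L0.
    - by near: t; exact: nbhs_left_gt.
    - by near: t; exact: nbhs_left_lt.
  exact: cvg_cst.
by move=> /cvg_lim L0'; have := oner_neq0 R; rewrite -(cvg_lim _ L1) // L0' // eqxx.
Unshelve. all: by end_near. Qed.

Unset Implicit Arguments.
Set Strict Implicit.

Theorem proposition2p2 (R : realType) (lam : nat -> R)
    (lam_distinct : forall i j : nat,
       (1 <= i)%N -> (1 <= j)%N -> i <> j -> lam i <> lam j)
    (lam_gt : forall j : nat, (1 <= j)%N -> - (1 / 2) < lam j)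
    (n : nat) (n_ge1 : (1 <= n)%N)
    (x : R) (x_gt0 : 0 < x) (x_le1 : x <= 1) :
  (* 1) *)
  (muntz lam n x =
     \sum_(1 <= j < n.+1) (1 + 2 * lam j) * muntz_legendre lam j x /\
   muntz lam n 1 = \sum_(1 <= j < n.+1) (1 + 2 * lam j) /\
   (derivable (fun t : R => t `^ (lam n + 1) * muntz_legendre lam n t) x 1 /\
    muntz lam n x = x `^ (- lam n) *
      derive1 (fun t : R => t `^ (lam n + 1) * muntz_legendre lam n t) x) /\
   ((@lebesgue_measure R).-integrable `]0, x]
      (fun s : R => (s `^ lam n * muntz lam n s)%:E) /\
    muntz_legendre lam n x = x `^ (- lam n - 1) *
      \int[@lebesgue_measure R]_(s in `]0, x]) (s `^ lam n * muntz lam n s)) /\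
   (forall mu : nat -> R, reordering n lam mu ->
      muntz mu n x = muntz lam n x) /\
   ((2 <= n)%N -> exists mu : nat -> R, reordering n lam mu /\
      exists y : R, 0 < y /\ y <= 1 /\
        muntz_legendre mu n y <> muntz_legendre lam n y)) /\
  (* 2) *)
  ((@lebesgue_measure R).-integrable `[x, 1]
     (fun u : R => (u `^ (- lam n - 1) * muntz lam n.-1 u)%:E) /\
   muntz lam n x = muntz lam n.-1 x +
     (2 * lam n + 1) * x `^ lam n *
       (1 - \int[@lebesgue_measure R]_(u in `[x, 1])
              (u `^ (- lam n - 1) * muntz lam n.-1 u))).
Proof.
have us : uniq [seq lam i | i <- iota 1 n].
  rewrite map_inj_in_uniq ?iota_uniq // => i j.
  rewrite !mem_iota => /andP[i1 _] /andP[j1 _] lamE.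
  by apply: contrapT => /lam_distinct; apply.
have dxL := @is_derive_powR_muntz_legendre R lam n n_ge1 x x_gt0.
have [intK IK] := integral_powR_muntz n_ge1 lam_gt x_gt0.
have powRK q (u : R) : x `^ q * u / x `^ q = u.
  by rewrite mulrAC divff ?mul1r // powR_eq0 (gt_eqF x_gt0).
split; [do ?split => // |].
- exact: muntz_sum.
- exact: muntz_at1.
- have [_ ] := dxL.
  by rewrite derive1E => ->; rewrite mulrC powRN powRK.
- by rewrite IK -opprD mulrC powRN powRK.
- by move=> mu; exact: muntz_reordering.
- exact: muntz_legendre_order_dependent.
(* The lemma is indexed by the predecessor, with K_0 = 0 covering n = 1. Its bracket is L_n(x),
   which turns part 2 into the recursion for K_n. *)
have [intK' IK'] := integral_powRN_muntz n.-1 lam_distinct x_gt0 x_le1.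
rewrite prednK // in intK' IK'; split=> //.
rewrite -mulrA IK' -{1}(prednK n_ge1) muntz_recr // prednK //.
by rewrite (addrC 1).
Qed.
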